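(* Suppose $N>K$, $2\le g\le \frac{K}{3\lceil N/M\rceil}$ and $\lceil N/M\rceil\le \frac{K}{\frac{27}{4}\log K}$. Use the new placement scheme with $F=\lceil N/M\rceil F'$ packets per file, where $F'=c\binom{K}{g}\big(\log\binom{K}{g}\big)^2$ for a constant $c>0$ (so $F=O\big(\binom{K}{g}(\log\binom{K}{g})^2\lceil N/M\rceil\big)$), and use the modified (pull-down) delivery scheme with parameter $g$. Then for every demand vector $\mathbf{d}\in[1:N]^K$, $$\mathbb{E}\big[R^{md}(\mathcal{C},\mathbf{d})\big]\le \frac43\,\frac{K}{g+1}\,(1+o(1)),$$ where the expectation is over the randomness of both placement and delivery and $o(1)\to0$ as $K\to\infty$.
   Context: Setting: a server holds a library of $N$ files, each split into $F$ packets (packet $f$ of file $n$ denoted $(n,f)$); $K$ users each have a cache of size $M$ files ($M\le N$). For a cache configuration $\mathcal{C}$, $S_{n,f}\subseteq[1:K]$ is the set of users whose cache stores packet $(n,f)$. User $k$ requests file $d_k$. New placement scheme: $F=\lceil N/M\rceil F'$ with $F'$ a positive integer; the packets of every file are partitioned into $F'$ groups of $\lceil N/M\rceil$ packets. For every user $k$, file $n$ and group, exactly one packet of the group is chosen uniformly at random and stored in user $k$'s cache; all choices are independent. Modified delivery scheme with parameter $g$: (1) Pull-down phase: for every $k\in[1:K]$ and $f\in[1:F]$ with $|S_{d_k,f}|\ge g+1$, replace $S_{d_k,f}$ (virtually, for delivery purposes only) by a uniformly random $g$-element subset of $S_{d_k,f}$, independently; other sets are unchanged. (2) With these modified sets,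 for $k\in[1:K]$ and $T\subseteq[1:K]\setminus\{k\}$ let $V_{k,T}$ be the set of packets $f$ of file $d_k$ whose (modified) set equals $T$; for every nonempty $\mathcal{S}\subseteq[1:K]$ transmit the XOR of the zero-padded packet vectors $V_{k,\mathcal{S}\setminus\{k\}}$, $k\in\mathcal{S}$. The normalized number of transmissions is $$R^{md}(\mathcal{C},\mathbf{d})=\sum_{\emptyset\ne\mathcal{S}\subseteq[1:K]}\frac{\max_{k\in\mathcal{S}}|V_{k,\mathcal{S}\setminus\{k\}}|}{F},$$ a random variable depending on the placement and on the random choices in the pull-down phase. *)

(* Defs.v *)
From mathcomp Require Import all_boot all_order all_algebra.
From mathcomp Require Import all_classical all_reals all_analysis.
Set Implicit Arguments. Unset Strict Implicit. Unset Printing Implicit Defensive.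
Import Order.TTheory GRing.Theory Num.Theory.
Local Open Scope ring_scope.

(* Packet f of a file is identified with a pair (j, i) : 'I_F' * 'I_q
   (group j, position i inside the group); so F = q * F'. *)
Definition packet (F' q : nat) := ('I_F' * 'I_q)%type.

(* A placement of the new scheme: for every user k, file n and group j,
   the index (in 'I_q) of the packet of the group stored by user k. *)
Definition placement (K N F' q : nat) := {ffun 'I_K * 'I_N * 'I_F' -> 'I_q}.

Definition Sset (K N F' q : nat) (C : placement K N F' q) (n : 'I_N)
  (f : packet F' q) : {set 'I_K} :=
  [set k | C (k, n, f.1) == f.2].

Definition pulldown_choices (K g : nat) (S : {set 'I_K}) : {set {set 'I_K}} :=
  if (g.+1 <= #|S|)%N then [set T : {set 'I_K} | (T \subset S) && (#|T| == g)] else [set S].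

(* Outcome of the pull-down phase: modified set for every (k, f)
   (the modified version of S_{d_k, f}). *)
Definition pulldown (K F' q : nat) := {ffun 'I_K * packet F' q -> {set 'I_K}}.

(* Admissible pull-down outcomes for placement C and demand d; the uniform
   distribution on this set is the product of the independent uniform choices. *)
Definition pulldown_outcomes (K N F' q g : nat) (C : placement K N F' q)
  (d : 'I_K -> 'I_N) : {set pulldown K F' q} :=
  [set h : pulldown K F' q |
     [forall x : 'I_K * packet F' q, h x \in pulldown_choices g (Sset C (d x.1) x.2)]].

Definition Vcard (K F' q : nat) (h : pulldown K F' q) (k : 'I_K) (T : {set 'I_K}) : nat :=
  #|[set f : packet F' q | h (k, f) == T]|.

Definition Rmd (R : realType) (K F' q : nat) (h : pulldown K F' q) : R :=
  (\sum_(S : {set 'I_K} | S != finset.set0) (\max_(k in S) Vcard h k (S :\ k))%N%:R)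
    / (q * F')%N%:R.

Definition avg (R : realType) (T : finType) (A : {set T}) (f : T -> R) : R :=
  (\sum_(x in A) f x) / #|A|%:R.

Definition expected_Rmd (R : realType) (K N F' q g : nat) (d : 'I_K -> 'I_N) : R :=
  avg [set: placement K N F' q]
      (fun C => avg (pulldown_outcomes g C d) (fun h => Rmd R h)).

(* Main.v *)
(* Only the sets [S] of size [g + 1] matter. A packet whose modified set has size
   different from [g] is stored by fewer than [g] users; the number of users
   storing it is binomial with mean [K / q >= max (3 g) (27/4 ln K)], so a Chernoff bound
   makes its probability [<= K ^ (- 9/8)] and the other sets cost
   [K ^ (- 1/8)] relative to [K / (g + 1)].

   For [#|T| = g], different groups contribute independently to
   [V_{k, T}], and a group contributes at most one packet, because the packets
   of a group are stored by disjoint sets of users. Hence [V_{k, T}] is binomial,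
   and by symmetry its mean is at most [mu = F' q / 'C(K, g)], which is at least
   [c (ln 'C(K, g)) ^ 2]. Exponential moments at parameter [1/8] then bound the
   expected maximum of [g + 1] such variables by [(5/4 + 1/24) mu] for large [K],
   and ['C(K, g + 1) / 'C(K, g) <= K / (g + 1)].

   The slack between [1] and [4/3] absorbs the error terms, so [eps] can be taken
   to vanish for large [K]; for small [K] the bound [R^md <= K] is enough. *)

Require Import Defs.
From mathcomp Require Import all_boot all_order all_algebra.
From mathcomp Require Import all_classical all_reals all_analysis.
From mathcomp Require Import fintype finset fingroup perm ring lra.
Import Order.TTheory GRing.Theory Num.Theory.
Import numFieldNormedType.Exports.
Set Implicit Arguments.
Unset Strict Implicit.
Local Open Scope ring_scope.

(** * Uniform averages over finite sets, and independence of product choices *)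

Lemma prod_pair (R : realType) (I J : finType) (f : I * J -> R) :
  \prod_x f x = \prod_i \prod_j f (i, j).
Proof. by rewrite pair_bigA; apply: eq_bigr => -[]. Qed.

Lemma ler_avg (R : realType) (T : finType) (A : {set T}) (f h : T -> R) :
  (forall x, x \in A -> f x <= h x) -> avg A f <= avg A h.
Proof. by move=> fh; rewrite /avg ler_wpM2r ?invr_ge0 // ler_sum. Qed.

Lemma eq_avg (R : realType) (T : finType) (A : {set T}) (f h : T -> R) :
  (forall x, x \in A -> f x = h x) -> avg A f = avg A h.
Proof. by move=> fh; rewrite /avg (eq_bigr h). Qed.

Lemma avgD (R : realType) (T : finType) (A : {set T}) (f h : T -> R) :
  avg A (fun x => f x + h x) = avg A f + avg A h.
Proof. by rewrite /avg big_split mulrDl. Qed.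

Lemma avgZ (R : realType) (T : finType) (A : {set T}) (a : R) (f : T -> R) :
  avg A (fun x => a * f x) = a * avg A f.
Proof. by rewrite /avg -mulr_sumr mulrA. Qed.

Lemma avg_sum (R : realType) (T I : finType) (A : {set T}) (P : pred I) (f : I -> T -> R) :
  avg A (fun x => \sum_(i | P i) f i x) = \sum_(i | P i) avg A (f i).
Proof. by rewrite /avg exchange_big mulr_suml. Qed.

Lemma avg_cst (R : realType) (T : finType) (A : {set T}) (a : R) :
  (0 < #|A|)%N -> avg A (fun=> a) = a.
Proof.
by move=> A0; rewrite /avg sumr_const -(mulr_natr a) mulfK // pnatr_eq0 -lt0n.
Qed.

Lemma avg_bij (R : realType) (T U : finType) (e : T -> U) (f : U -> R) :
  bijective e -> avg [set: T] (fun x => f (e x)) = avg [set: U] f.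
Proof.
move=> be; have ie := bij_inj be.
have cTU : #|[set: T]| = #|[set: U]|.
  by rewrite !cardsT; apply: bij_eq_card be.
rewrite /avg cTU; congr (_ / _); rewrite [RHS](reindex e) /=; last first.
  by apply: onW_bij.
by apply: eq_bigl => x; rewrite !inE.
Qed.

(** Independence of coordinates under the uniform law on a product set: by distributivity both the
    sum and the cardinality factor over the coordinates. The cardinality is the same sum taken with
    all factors equal to 1. *)
Lemma avg_family (R : realType) (I T : finType) (P : I -> {set T}) (phi : I -> T -> R) :
  avg [set h : {ffun I -> T} | [forall x, h x \in P x]]
      (fun h => \prod_x phi x (h x)) = \prod_x avg (P x) (phi x).
Proof.
have sumE (psi : I -> T -> R) :
    \sum_(h in [set h : {ffun I -> T} | [forall x, h x \in P x]])
      \prod_x psi x (h x) = \prod_x \sum_(t in P x) psi x t.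
  rewrite bigA_distr_big_dep; apply: eq_bigl => h; rewrite inE.
  by apply/forallP/familyP => hP x; have := hP x.
rewrite /avg sumE prodf_div; congr (_ / _).
transitivity (\prod_x \sum_(t in P x) (1 : R)).
  rewrite -(sumE (fun _ _ => 1)) [RHS](eq_bigr (fun=> 1)) ?sumr_const // => h _.
  by rewrite big1.
by apply: eq_bigr => x _; rewrite sumr_const.
Qed.

Lemma avg_ffun (R : realType) (I T : finType) (phi : I -> T -> R) :
  avg [set: {ffun I -> T}] (fun h => \prod_x phi x (h x)) =
  \prod_x avg [set: T] (phi x).
Proof.
rewrite -(avg_family (fun=> [set: T]%SET)); congr avg.
by apply/setP => h; rewrite !inE; apply/esym/forallP => x; rewrite inE.
Qed.

(** A placement can be regrouped as a family of columns, one for each pair of a file and a group,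
    and these columns are independent and uniform. Columns of files other than [n] receive the
    factor 1 and average out. *)
Lemma avg_column (R : realType) (K N F' q : nat) (n : 'I_N)
    (phi : 'I_F' -> {ffun 'I_K -> 'I_q} -> R) : (0 < q)%N ->
  avg [set: placement K N F' q]
      (fun C => \prod_j phi j [ffun k => C (k, n, j)]) =
  \prod_j avg [set: {ffun 'I_K -> 'I_q}] (phi j).
Proof.
move=> q0.
have col0 : (0 < #|[set: {ffun 'I_K -> 'I_q}]|)%N.
  by rewrite cardsT card_ffun !card_ord expn_gt0 q0.
pose e (D : {ffun 'I_N * 'I_F' -> {ffun 'I_K -> 'I_q}}) : placement K N F' q :=
  [ffun x => D (x.1.2, x.2) x.1.1].
pose e' (C : placement K N F' q) : {ffun 'I_N * 'I_F' -> {ffun 'I_K -> 'I_q}} :=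
  [ffun y => [ffun k => C (k, y.1, y.2)]].
have be : bijective e.
  exists e' => [D|C]; first by apply/ffunP => -[m j]; apply/ffunP => k; rewrite !ffunE.
  by apply/ffunP => -[[k m] j]; rewrite !ffunE.
rewrite -(avg_bij _ be).
pose psi (y : 'I_N * 'I_F') c := if y.1 == n then phi y.2 c else 1.
rewrite (eq_avg (h := fun D : {ffun 'I_N * 'I_F' -> {ffun 'I_K -> 'I_q}} =>
  \prod_y psi y (D y))); last first.
  move=> D _; rewrite prod_pair.
  rewrite (bigD1 n) //= [X in _ * X]big1 ?mulr1; last first.
    by move=> m mn; rewrite big1 // => j _; rewrite /psi (negbTE mn).
  apply: eq_bigr => j _; rewrite /psi eqxx; congr phi.
  by apply/ffunP => k; rewrite !ffunE.
rewrite avg_ffun prod_pair.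
rewrite (bigD1 n) //= [X in _ * X]big1 ?mulr1; last first.
  move=> m mn; rewrite big1 // => j _.
  rewrite (eq_avg (h := fun=> 1)) ?avg_cst // => c _.
  by rewrite /psi (negbTE mn).
by apply: eq_bigr => j _; apply: eq_avg => c _; rewrite /psi eqxx.
Qed.

(** * Law of the modified set of a packet, and its symmetry under relabelling of users *)

(** List [A] followed by its complement, and likewise [B]; sending each entry of the first list to
    the entry of the second at the same position is a permutation taking [A] to [B]. *)
Lemma ex_perm_imset (T : finType) (A B : {set T}) :
  #|A| = #|B| -> exists s : {perm T}, [set s x | x in A]%SET = B.
Proof.
move=> cAB; pose a := enum A ++ enum (~: A); pose b := enum B ++ enum (~: B).
have uniq_split (D : {set T}) : uniq (enum D ++ enum (~: D)).
  rewrite cat_uniq !enum_uniq andbT /=; apply/hasPn => x.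
  by rewrite !mem_enum inE.
have mem_split (D : {set T}) x : x \in enum D ++ enum (~: D).
  by rewrite mem_cat !mem_enum inE orbN.
have size_ab : size a = size b.
  by rewrite !size_cat -!cardE [#|~: A|]cardsCs [#|~: B|]cardsCs !setCK cAB.
have [x0 _|T0] := pickP T; last first.
  exists 1%g; apply/setP => x; by have := T0 x.
pose f x := nth x0 b (index x a).
have ltb x : (index x a < size b)%N by rewrite -size_ab index_mem mem_split.
have injf : injective f.
  move=> x y /eqP; rewrite nth_uniq ?uniq_split // => /eqP.
  by move/(congr1 (nth x0 a)); rewrite !nth_index ?mem_split.
exists (perm injf); apply/eqP; rewrite eqEcard card_imset ?cAB ?leqnn ?andbT; last exact: perm_inj.
apply/subsetP => _ /imsetP[x xA ->]; rewrite permE /f nth_cat.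
have ixA : (index x a < size (enum B))%N.
  by rewrite -cardE -cAB cardE /a index_cat mem_enum xA index_mem mem_enum.
by rewrite ixA -mem_enum mem_nth.
Qed.

Lemma pulldown_choices_gt0 (K g : nat) (S : {set 'I_K}) :
  (0 < #|pulldown_choices g S|)%N.
Proof.
rewrite /pulldown_choices; case: ifP => gS; last by rewrite cards1.
by rewrite cards_draws bin_gt0 ltnW.
Qed.

Lemma pulldown_choicesS (K g : nat) (S T : {set 'I_K}) :
  T \in pulldown_choices g S -> T \subset S.
Proof.
rewrite /pulldown_choices; case: ifP => _; rewrite inE; first by case/andP.
by move/eqP->.
Qed.

Lemma pulldown_outcomes_gt0 (K N F' q g : nat) (C : placement K N F' q)
    (d : 'I_K -> 'I_N) : (0 < #|pulldown_outcomes g C d|)%N.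
Proof.
have ne (S : {set 'I_K}) : exists T, T \in pulldown_choices g S.
  by apply/set0Pn; rewrite -card_gt0 pulldown_choices_gt0.
rewrite card_gt0; apply/set0Pn.
exists [ffun x => xchoose (ne (Sset C (d x.1) x.2))].
by rewrite inE; apply/forallP => x; rewrite ffunE; apply: xchooseP.
Qed.

(** Conditional probability that the pull-down phase yields the modified set [T] for a packet cached
    exactly by the users in [S]. *)
Definition hit_prob (R : realType) (K g : nat) (S T : {set 'I_K}) : R :=
  avg (pulldown_choices g S) (fun U => (U == T)%:R).

Lemma hit_probE (R : realType) (K g : nat) (S T : {set 'I_K}) :
  hit_prob R g S T = (T \in pulldown_choices g S)%:R / #|pulldown_choices g S|%:R.
Proof.
rewrite /hit_prob /avg; congr (_ / _).
have [TA|TA] := boolP (T \in _).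
  by rewrite (bigD1 T) //= eqxx big1 ?addr0 // => U /andP[_ /negbTE->].
by rewrite big1 // => U UA; case: eqP => // UT; rewrite -UT UA in TA.
Qed.

Lemma sum_hit_prob (R : realType) (K g : nat) (S : {set 'I_K}) :
  \sum_T hit_prob R g S T = 1.
Proof.
rewrite -avg_sum -[RHS](avg_cst 1 (pulldown_choices_gt0 g S)).
apply: eq_avg => U _; rewrite (bigD1 U) //= eqxx big1 ?addr0 // => T TU.
by rewrite eq_sym (negbTE TU).
Qed.

Lemma hit_prob_ge0 (R : realType) (K g : nat) (S T : {set 'I_K}) : 0 <= hit_prob R g S T.
Proof. by rewrite hit_probE divr_ge0. Qed.

Lemma hit_prob_eq0 (R : realType) (K g : nat) (S T : {set 'I_K}) :
  ~~ (T \subset S) -> hit_prob R g S T = 0.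
Proof.
move=> nTS; rewrite hit_probE; case: (boolP (T \in _)); last by rewrite mul0r.
by move/pulldown_choicesS => TS; rewrite TS in nTS.
Qed.

Lemma hit_prob_perm (R : realType) (K g : nat) (s : {perm 'I_K}) (S T : {set 'I_K}) :
  hit_prob R g [set s x | x in S]%SET [set s x | x in T]%SET = hit_prob R g S T.
Proof.
have si : injective (fun A : {set 'I_K} => [set s x | x in A]%SET).
  by apply: imset_inj; apply: perm_inj.
have cs (A : {set 'I_K}) : #|[set s x | x in A]%SET| = #|A|.
  by rewrite card_imset //; apply: perm_inj.
have subs (A B : {set 'I_K}) :
    ([set s x | x in A]%SET \subset [set s x | x in B]%SET) = (A \subset B).
  apply/idP/idP => [|/imsetS]; last exact.
  move=> /subsetP AB; apply/subsetP => x xA.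
  by have /imsetP[y yB /perm_inj->] := AB _ (imset_f s xA).
rewrite !hit_probE /pulldown_choices cs; case: ifP => _.
  by rewrite !cards_draws cs !inE subs cs.
by rewrite !cards1 !inE (inj_eq si).
Qed.

Definition slot (K q : nat) (c : {ffun 'I_K -> 'I_q}) (i : 'I_q) : {set 'I_K} :=
  [set k | c k == i].

(** Expected number of packets of one group whose modified set is [T]. The column [c] records the
    choices of all users in that group, so [slot c i] is the set of users caching its packet [i]. *)
Definition hit_rate (R : realType) (K q g : nat) (T : {set 'I_K}) : R :=
  avg [set: {ffun 'I_K -> 'I_q}] (fun c => \sum_i hit_prob R g (slot c i) T).

Lemma hit_rate_perm (R : realType) (K q g : nat) (s : {perm 'I_K}) (T : {set 'I_K}) :
  hit_rate R q g [set s x | x in T]%SET = hit_rate R q g T.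
Proof.
(* Precomposing with the inverse of [s] makes each slot of [e c] the image under [s] of the same
   slot of [c]. *)
pose e (c : {ffun 'I_K -> 'I_q}) : {ffun 'I_K -> 'I_q} := [ffun k => c ((s^-1)%g k)].
have be : bijective e.
  exists (fun c : {ffun 'I_K -> 'I_q} => [ffun k => c (s k)]) => c;
    apply/ffunP => k; rewrite !ffunE.
    by rewrite permK.
  by rewrite permKV.
rewrite /hit_rate -(avg_bij _ be); apply: eq_avg => c _; apply: eq_bigr => i _.
rewrite -[RHS](hit_prob_perm _ _ s); congr hit_prob; apply/setP => k.
rewrite inE ffunE -{2}[k](permKV s) mem_imset ?inE //; exact: perm_inj.
Qed.

Lemma sum_sets_cst (R : realType) (K m : nat) (a : R) :
  \sum_(U : {set 'I_K} | #|U| == m) a = 'C(K, m)%:R * a.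
Proof.
rewrite sumr_const mulr_natl; congr (_ *+ _).
have := @cards_draws _ [set: 'I_K]%SET m; rewrite cardsT card_ord => <-.
by rewrite cardsE; apply: eq_card => U; rewrite /in_mem /= subsetT.
Qed.

(* By symmetry all [T] of size [g] have the same rate, and a group of [q]
   packets hits at most [q] sets in total. *)
Lemma hit_rate_le (R : realType) (K q g : nat) (T : {set 'I_K}) :
  (0 < q)%N -> #|T| = g -> hit_rate R q g T <= q%:R / 'C(K, g)%:R.
Proof.
move=> q0 cT.
have C0 : 0 < ('C(K, g)%:R : R).
  by rewrite ltr0n bin_gt0 -cT -[K in (_ <= K)%N]card_ord max_card.
have col0 : (0 < #|[set: {ffun 'I_K -> 'I_q}]|)%N.
  by rewrite cardsT card_ffun !card_ord expn_gt0 q0.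
rewrite ler_pdivlMr //.
have -> : hit_rate R q g T * 'C(K, g)%:R = \sum_(U : {set 'I_K} | #|U| == g) hit_rate R q g U.
  rewrite (eq_bigr (fun=> hit_rate R q g T)); first by rewrite sum_sets_cst mulrC.
  move=> U /eqP cU; have [|s <-] := @ex_perm_imset _ T U; first by rewrite cT cU.
  by rewrite hit_rate_perm.
rewrite -avg_sum -[leRHS](avg_cst q%:R col0).
apply: ler_avg => c _; rewrite exchange_big /=.
apply: (@le_trans _ _ (\sum_(i < q) 1)); last by rewrite sumr_const card_ord.
apply: ler_sum => i _; rewrite -(sum_hit_prob R g (slot c i)).
rewrite [leRHS](bigID (fun U : {set 'I_K} => #|U| == g)) /= lerDl.
by rewrite sumr_ge0 // => U _; apply: hit_prob_ge0.
Qed.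

(** * Generating functions of the packet counts and of the cache-set sizes *)

(** The power of [y] is a product over packets of [y] on a hit and 1 otherwise. Given the placement
    the pull-down choices are independent, and a factor with hit probability [p] has mean
    [1 + (y - 1) * p]. *)
Lemma avg_expVcard (R : realType) (K N F' q g : nat) (C : placement K N F' q)
    (d : 'I_K -> 'I_N) (k : 'I_K) (T : {set 'I_K}) (y : R) :
  avg (pulldown_outcomes g C d) (fun h => y ^+ Vcard h k T) =
  \prod_(f : packet F' q) (1 + (y - 1) * hit_prob R g (Sset C (d k) f) T).
Proof.
pose phi (x : 'I_K * packet F' q) (U : {set 'I_K}) : R :=
  if (x.1 == k) && (U == T) then y else 1.
rewrite (eq_avg (h := fun h : pulldown K F' q => \prod_x phi x (h x))); last first.
  move=> h _; rewrite prod_pair (bigD1 k) //= [X in _ * X]big1 ?mulr1; last first.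
    by move=> k' /negbTE k'k; rewrite big1 // => f _; rewrite /phi /= k'k.
  rewrite /phi /= eqxx /= -big_mkcond /= prodr_const; congr (_ ^+ _).
  by rewrite /Vcard cardsE.
rewrite avg_family prod_pair (bigD1 k) //= [X in _ * X]big1 ?mulr1; last first.
  move=> k' /negbTE k'k; rewrite big1 // => f _.
  rewrite -[RHS](avg_cst 1 (pulldown_choices_gt0 g (Sset C (d k') f))).
  by apply: eq_avg => U _; rewrite /phi /= k'k.
apply: eq_bigr => f _; rewrite /hit_prob -avgZ.
rewrite -[X in X + _](avg_cst 1 (pulldown_choices_gt0 g (Sset C (d k) f))) -avgD.
apply: eq_avg => U _; rewrite /phi /= eqxx /=.
by case: (U == T); rewrite ?mulr1 ?mulr0 ?addr0 // addrC subrK.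
Qed.

(* The sets [slot c i] are pairwise disjoint, so at most one of them contains
   the nonempty set [T] and the product has no higher-order term. *)
Lemma prod_slot (R : realType) (K q g : nat) (c : {ffun 'I_K -> 'I_q})
    (T : {set 'I_K}) (x : R) : T != set0 ->
  \prod_i (1 + x * hit_prob R g (slot c i) T) =
  1 + x * \sum_i hit_prob R g (slot c i) T.
Proof.
case/set0Pn => t tT.
have z i : i != c t -> hit_prob R g (slot c i) T = 0.
  move=> ic; apply: hit_prob_eq0; apply/negP => /subsetP/(_ t tT).
  by rewrite inE eq_sym (negbTE ic).
rewrite (bigD1 (c t)) //= [X in _ * X]big1 => [|i /z ->]; last by rewrite mulr0 addr0.
by rewrite mulr1 [in RHS](bigD1 (c t)) //= big1 ?addr0.
Qed.

(** This is the generating function of a binomial variable with [F'] trials, one per group, and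
    success probability [hit_rate R q g T]. *)
Lemma mgf_Vcard (R : realType) (K N F' q g : nat) (d : 'I_K -> 'I_N) (k : 'I_K)
    (T : {set 'I_K}) (y : R) : (0 < q)%N -> T != set0 ->
  avg [set: placement K N F' q]
      (fun C => avg (pulldown_outcomes g C d) (fun h => y ^+ Vcard h k T)) =
  (1 + (y - 1) * hit_rate R q g T) ^+ F'.
Proof.
move=> q0 T0; have col0 : (0 < #|[set: {ffun 'I_K -> 'I_q}]|)%N.
  by rewrite cardsT card_ffun !card_ord expn_gt0 q0.
rewrite (eq_avg (h := fun C : placement K N F' q => \prod_j
    (1 + (y - 1) * \sum_i hit_prob R g (slot [ffun l => C (l, d k, j)] i) T))).
  rewrite (@avg_column R K N F' q (d k)
    (fun _ c => 1 + (y - 1) * \sum_i hit_prob R g (slot c i) T)) //.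
  by rewrite prodr_const card_ord avgD avg_cst // avgZ.
move=> C _; rewrite avg_expVcard prod_pair; apply: eq_bigr => j _.
rewrite -prod_slot //; apply: eq_bigr => i _; congr (1 + _ * hit_prob _ _ _ _).
by apply/setP => l; rewrite !inE ffunE.
Qed.

Lemma mgf_Vcard_le (R : realType) (K N F' q g : nat) (d : 'I_K -> 'I_N) (k : 'I_K)
    (T : {set 'I_K}) (y : R) : (0 < q)%N -> (0 < g)%N -> #|T| = g -> 1 <= y ->
  avg [set: placement K N F' q]
      (fun C => avg (pulldown_outcomes g C d) (fun h => y ^+ Vcard h k T)) <=
  expR ((y - 1) * (F'%:R * q%:R / 'C(K, g)%:R)).
Proof.
move=> q0 g0 cT y1; rewrite mgf_Vcard //; last by rewrite -card_gt0 cT.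
have y0 : 0 <= y - 1 by rewrite subr_ge0.
have h0 : 0 <= hit_rate R q g T.
  rewrite mulr_ge0 ?invr_ge0 // sumr_ge0 // => c _.
  by rewrite sumr_ge0 // => i _; apply: hit_prob_ge0.
have -> : (y - 1) * (F'%:R * q%:R / 'C(K, g)%:R) = F'%:R * ((y - 1) * (q%:R / 'C(K, g)%:R)).
  by ring.
rewrite expRM_natl; apply: lerXn2r; rewrite ?nnegrE ?expR_ge0 //.
  by rewrite addr_ge0 // mulr_ge0.
apply: (le_trans (expR_ge1Dx _)); rewrite ler_expR.
by apply: ler_wpM2l => //; apply: hit_rate_le.
Qed.

(** Users cache [f] independently with probability [1 / q], so each contributes the mean factor
    [1 - 1 / q + 1 / (2 * q)]. This is the moment used in the Chernoff bound for the lower tail. *)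
Lemma avg_half_Sset (R : realType) (K N F' q : nat) (n : 'I_N) (f : packet F' q) :
  (0 < q)%N ->
  avg [set: placement K N F' q] (fun C => (1 / 2 : R) ^+ #|Sset C n f|) =
  (1 - 1 / (2 * q%:R)) ^+ K.
Proof.
move=> q0; case: f => j i; have qn0 : (q%:R : R) != 0 by rewrite pnatr_eq0 -lt0n.
pose psi (c : {ffun 'I_K -> 'I_q}) : R := \prod_k (if c k == i then 1 / 2 else 1).
rewrite (eq_avg (h := fun C : placement K N F' q => \prod_j'
    (if j' == j then psi [ffun k => C (k, n, j')] else 1))); last first.
  move=> C _; rewrite -big_mkcond big_pred1_eq /psi -big_mkcond prodr_const.
  by congr (_ ^+ _); apply: eq_card => k; rewrite inE /in_mem /= ffunE.
rewrite (@avg_column R K N F' q n (fun j' c => if j' == j then psi c else 1)) //.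
rewrite (bigD1 j) //= [X in _ * X]big1 ?mulr1; last first.
  move=> j' /negbTE j'j; rewrite (eq_avg (h := fun=> 1)) ?avg_cst // => [|c _].
    by rewrite cardsT card_ffun !card_ord expn_gt0 q0.
  by rewrite j'j.
rewrite eqxx (avg_ffun (fun _ c => if c == i then 1 / 2 else 1)) prodr_const card_ord.
congr (_ ^+ _); rewrite /avg cardsT card_ord.
rewrite (eq_bigr (fun c => 1 - (if c == i then 1 / 2 else 0) : R)); last first.
  by move=> c _; case: eqP => _; lra.
rewrite sumrB (eq_bigl xpredT) => [|c]; last by rewrite inE.
rewrite sumr_const card_ord (eq_bigl xpredT) => [|c]; last by rewrite inE.
by rewrite -big_mkcond big_pred1_eq; field.
Qed.

(** * Pointwise bounds on the transmission cost *)

(** Bound each maximum by a sum over [k]. A pair [(k, f)] can then be counted only at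
    [S = k |: h (k, f)], and there [#|S|.-1] is the size of [h (k, f)]. *)
Lemma sum_max_Vcard_le (K F' q : nat) (h : pulldown K F' q) (P : pred nat) :
  (\sum_(S : {set 'I_K} | (S != set0) && P #|S|.-1)
     \max_(k in S) Vcard h k (S :\ k) <=
   \sum_k \sum_f P #|h (k, f)|)%N.
Proof.
have VE k T : Vcard h k T = (\sum_f (h (k, f) == T))%N.
  rewrite /Vcard -sum1_card big_mkcond; apply: eq_bigr => f _.
  by rewrite inE; case: eqP.
apply: (@leq_trans (\sum_(S : {set 'I_K} | (S != set0) && P #|S|.-1)
    \sum_(k in S) Vcard h k (S :\ k))%N).
  apply: leq_sum => S _; apply/bigmax_leqP => k kS.
  by rewrite (bigD1 k) //= leq_addr.
rewrite (exchange_big_dep predT) //=; apply: leq_sum => k _.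
under eq_bigr do rewrite VE.
rewrite exchange_big /=; apply: leq_sum => f _.
rewrite big_mkcond /= -[leqRHS](@big_pred1_eq _ 0%N addn _ (k |: h (k, f))
  (fun=> nat_of_bool (P #|h (k, f)|))).
rewrite [leqRHS]big_mkcond /=; apply: leq_sum => S _.
case: ifP => [/andP[/andP[_ PS] kS]|_]; last by [].
case: eqP => [hS|_]; last by [].
by rewrite hS setD1K // eqxx; move: PS; rewrite (cardsD1 k S) kS add1n => ->.
Qed.

Lemma card_pulldown_neq (K N F' q g : nat) (C : placement K N F' q) (d : 'I_K -> 'I_N)
    (h : pulldown K F' q) (x : 'I_K * packet F' q) :
  h \in pulldown_outcomes g C d -> #|h x| != g -> (#|Sset C (d x.1) x.2| < g)%N.
Proof.
rewrite inE => /forallP/(_ x); rewrite /pulldown_choices.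
case: ifP => gS; rewrite inE; first by case/andP=> _ /eqP ->; rewrite eqxx.
by move=> /eqP -> ne; rewrite ltn_neqAle ne leqNgt gS.
Qed.

(** From [1 + u <= expR u] at [u = l * (x - t)] follows [x <= t + l^-1 * expR (l * (x - t))]. Take
    [x] to be the maximum and enlarge its single exponential to the sum over [S]. *)
Lemma bigmax_le_exp (R : realType) (I : finType) (S : {set I}) (v : I -> nat) (t l : R) :
  0 < l -> S != set0 ->
  (\max_(k in S) v k)%:R <= t + l^-1 * expR (- (l * t)) * \sum_(k in S) expR l ^+ v k.
Proof.
move=> l0 S0; have [|k kS ->] := @eq_bigmax_cond _ [in S] v; first by rewrite card_gt0.
rewrite -lerBlDl -mulrA ler_pdivlMl //.
rewrite (bigD1 k) //= [leRHS]mulrDr; apply: (@le_trans _ _ (expR (l * ((v k)%:R - t)))).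
  by apply: le_trans (expR_ge1Dx _); rewrite lerDr.
rewrite -expRM_natl -expRD; have -> : - (l * t) + (v k)%:R * l = l * ((v k)%:R - t) by ring.
rewrite lerDl mulr_ge0 ?expR_ge0 //.
by rewrite sumr_ge0 // => i _; rewrite exprn_ge0 ?expR_ge0.
Qed.

(** * Expectation over placement and pull-down, and bounds on the expected rate *)

(** The average is iterated because the set of pull-down outcomes depends on the placement;
    [expected_Rmd] is an instance by unfolding. *)
Definition expect (R : realType) (K N F' q g : nat) (d : 'I_K -> 'I_N)
    (X : placement K N F' q -> pulldown K F' q -> R) : R :=
  avg [set: placement K N F' q] (fun C => avg (pulldown_outcomes g C d) (X C)).

Section Expect.
Variables (R : realType) (K N F' q g : nat) (d : 'I_K -> 'I_N).
Implicit Types X Y : placement K N F' q -> pulldown K F' q -> R.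
Local Notation E := (@expect R K N F' q g d).

Lemma ler_expect X Y :
  (forall C h, h \in pulldown_outcomes g C d -> X C h <= Y C h) -> E X <= E Y.
Proof. by move=> XY; apply: ler_avg => C _; apply: ler_avg; apply: XY. Qed.

Lemma expectD X Y : E (fun C h => X C h + Y C h) = E X + E Y.
Proof. by rewrite /expect -avgD; apply: eq_avg => C _; rewrite avgD. Qed.

Lemma expectZ a X : E (fun C h => a * X C h) = a * E X.
Proof. by rewrite /expect -avgZ; apply: eq_avg => C _; rewrite avgZ. Qed.

Lemma expect_sum (I : finType) (P : pred I) (X : I -> placement K N F' q -> pulldown K F' q -> R) :
  E (fun C h => \sum_(i | P i) X i C h) = \sum_(i | P i) E (X i).
Proof. by rewrite /expect -avg_sum; apply: eq_avg => C _; rewrite avg_sum. Qed.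

Lemma expect_placement (X : placement K N F' q -> R) :
  E (fun C _ => X C) = avg [set: placement K N F' q] X.
Proof. by apply: eq_avg => C _; rewrite avg_cst ?pulldown_outcomes_gt0. Qed.

Lemma expect_cst a : (0 < q)%N -> E (fun _ _ => a) = a.
Proof.
move=> q0; rewrite expect_placement avg_cst //.
by rewrite cardsT card_ffun !card_ord expn_gt0 q0.
Qed.

End Expect.

(** Each of the [K * F' * q] pairs of a user and a packet is charged at most once. For [F' = 0] the
    rate is 0, since division by zero gives zero. *)
Lemma expected_Rmd_le_users (R : realType) (K N g q F' : nat) (d : 'I_K -> 'I_N) :
  (0 < q)%N -> @expected_Rmd R K N F' q g d <= K%:R.
Proof.
move=> q0; have [->|F0] := posnP F'.
  rewrite /expected_Rmd (eq_avg (h := fun=> 0)) ?avg_cst //.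
    by rewrite cardsT card_ffun !card_ord expn_gt0 q0.
  move=> C _; rewrite (eq_avg (h := fun=> 0)) ?avg_cst ?pulldown_outcomes_gt0 //.
  by move=> h _; rewrite /Rmd muln0 invr0 mulr0.
rewrite -[leRHS](expect_cst F' g d _ q0); apply: ler_expect => C h _.
rewrite /Rmd ler_pdivrMr ?ltr0n ?muln_gt0 ?q0 // -natr_sum -natrM ler_nat.
rewrite (eq_bigl (fun S : {set 'I_K} => (S != set0) && xpredT #|S|.-1)); last first.
  by move=> S; rewrite /= andbT.
apply: (leq_trans (sum_max_Vcard_le h xpredT)).
by rewrite !sum_nat_const card_prod !card_ord [(F' * q)%N]mulnC muln1.
Qed.

Lemma expected_Rmd_le (R : realType) (K N g q F' : nat) (d : 'I_K -> 'I_N) (l t : R) :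
  (0 < q)%N -> (0 < g)%N -> (0 < F')%N -> 0 < l ->
  @expected_Rmd R K N F' q g d <=
  (q%:R * F'%:R)^-1 *
  ('C(K, g.+1)%:R * (t + l^-1 * expR (- (l * t)) *
     (g.+1%:R * expR ((expR l - 1) * (F'%:R * q%:R / 'C(K, g)%:R)))) +
   K%:R * (F'%:R * q%:R * (2 ^+ g * (1 - 1 / (2 * q%:R)) ^+ K))).
Proof.
move=> q0 g0 F0 l0.
(* [big] dominates the maximum over a set of size [g + 1]. [small] dominates the indicator that the
   modified set of [(k, f)] does not have size [g]: in that case fewer than [g] users cache the
   packet, so [2 ^ (g - #|Sset C (d k) f|)] is at least 1. *)
pose big (S : {set 'I_K}) (C : placement K N F' q) (h : pulldown K F' q) : R :=
  t + l^-1 * expR (- (l * t)) * \sum_(k in S) expR l ^+ Vcard h k (S :\ k).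
pose small (k : 'I_K) (f : packet F' q) (C : placement K N F' q) (h : pulldown K F' q) : R :=
  2 ^+ g * (1 / 2) ^+ #|Sset C (d k) f|.
have F0' : 0 < (q%:R * F'%:R : R) by rewrite mulr_gt0 ?ltr0n.
apply: (@le_trans _ _ (expect g d (fun C h => (q%:R * F'%:R)^-1 *
    (\sum_(S : {set 'I_K} | #|S| == g.+1) big S C h + \sum_k \sum_f small k f C h)))).
  apply: ler_expect => C h hC; rewrite /Rmd natrM mulrC ler_pM2l ?invr_gt0 //.
  rewrite (bigID (fun S : {set 'I_K} => #|S| == g.+1)) /=; apply: lerD.
    rewrite (eq_bigl (fun S : {set 'I_K} => #|S| == g.+1)) => [|S]; last first.
      by case: (#|S| =P g.+1) => [cS|_]; rewrite ?andbF ?andbT // -card_gt0 cS.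
    by apply: ler_sum => S /eqP cS; apply: bigmax_le_exp; rewrite -?card_gt0 ?cS.
  rewrite (eq_bigl (fun S : {set 'I_K} => (S != set0) && (#|S|.-1 != g))); last first.
    by move=> S; rewrite -card_gt0; case: #|S|.
  rewrite -natr_sum; apply: (@le_trans _ _ (\sum_k \sum_f (#|h (k, f)| != g))%:R).
    by rewrite ler_nat (sum_max_Vcard_le h (fun m => m != g)).
  rewrite natr_sum; apply: ler_sum => k _; rewrite natr_sum; apply: ler_sum => f _.
  rewrite /small; case: (boolP (_ == _)) => [_|/(card_pulldown_neq hC) /= lt_g].
    by rewrite mulr_ge0 ?exprn_ge0 // divr_ge0.
  rewrite expr_div_n expr1n mul1r ler_pdivlMr ?exprn_gt0 // mul1r.
  by apply: ler_weXn2l; [rewrite ler1n | apply: ltnW].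
rewrite expectZ ler_pM2l ?invr_gt0 // expectD; apply: lerD.
  rewrite expect_sum -sum_sets_cst; apply: ler_sum => S /eqP cS.
  rewrite expectD expect_cst // expectZ expect_sum lerD2l; apply: ler_wpM2l.
    by rewrite mulr_ge0 ?expR_ge0 // invr_ge0 ltW.
  rewrite mulr_natl -cS -sumr_const; apply: ler_sum => k kS.
  apply: mgf_Vcard_le => //; last by rewrite -expR0 ler_expR ltW.
  by apply/eqP; rewrite -eqSS -cS (cardsD1 k S) kS.
rewrite expect_sum mulr_natl -[X in _ *+ X]card_ord -sumr_const.
apply: ler_sum => k _; rewrite expect_sum.
rewrite -natrM mulr_natl; have <- : #|{: 'I_F' * 'I_q}| = (F' * q)%N by rewrite card_prod !card_ord.
rewrite -sumr_const.
by apply: ler_sum => f _; rewrite /small expectZ expect_placement avg_half_Sset.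
Qed.

(** * Numerical estimates for large [K] *)

(** Induction with Pascal's rule. It carries a lower bound on [ln K] over to the logarithm of
    ['C(K, g)]. *)
Lemma leq_bin_self (n m : nat) : (0 < m < n)%N -> (n <= 'C(n, m))%N.
Proof.
elim: n m => [|n IHn] [|m] //=; rewrite ltnS leq_eqVlt => /orP[/eqP ->|mn].
  by rewrite binSn.
by rewrite binS -[n.+1]addn1 leq_add ?IHn ?bin_gt0 // ltnW // ltnW.
Qed.

(** Invert [expR (- (1 / 8)) >= 7 / 8]. *)
Lemma expR_eighth (R : realType) : expR (1 / 8 : R) - 1 <= 1 / 7.
Proof.
have e0 := expR_gt0 (1 / 8 : R).
have := expR_ge1Dx (- (1 / 8) : R); rewrite expRN -(ler_pM2r e0) mulVf ?gt_eqF // => ?; lra.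
Qed.

(** The total exponent is at most [L - 5/32 * mu + 1/7 * mu = L - 3/224 * mu <= 0], so the
    exponential term is at most 8, which is at most [mu / 24]; and [5/4 + 1/24 = 31/24]. *)
Lemma exp_moment_small (R : realType) (mu L m : R) :
  0 <= m -> m <= expR L -> L <= 3 / 224 * mu -> 192 <= mu ->
  5 / 4 * mu + (1 / 8)^-1 * expR (- (1 / 8 * (5 / 4 * mu))) *
    (m * expR ((expR (1 / 8) - 1) * mu)) <= 31 / 24 * mu.
Proof.
move=> m0 mL Lmu mu192; set x := expR _ - 1.
have x7 : x * mu <= 1 / 7 * mu by rewrite ler_wpM2r ?expR_eighth //; lra.
have -> : (1 / 8)^-1 = 8 :> R by lra.
suff : m * (expR (- (1 / 8 * (5 / 4 * mu))) * expR (x * mu)) <= 1 by lra.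
rewrite -expRD; apply: (le_trans (ler_pM m0 (expR_ge0 _) mL (lexx _))).
rewrite -expRD -[leRHS]expR0 ler_expR; lra.
Qed.

(** With [a = K / q], the left side is at most [expR (a / 3 - a / 2) = expR (- a / 6)], and
    [a >= 27/4 * ln K] makes this at most [K ^ (- 9/8)]. Multiplying by [g + 1 <= K] leaves
    [K ^ (- 1/8)], below [1/24] once [ln K >= 192]. *)
Lemma lower_tail_small (R : realType) (K g q : nat) :
  (0 < q)%N -> (g < K)%N ->
  (g%:R : R) <= K%:R / (3 * q%:R) ->
  (q%:R : R) <= K%:R / (27 / 4 * ln K%:R) ->
  192 <= ln (K%:R : R) ->
  2 ^+ g * (1 - 1 / (2 * q%:R)) ^+ K <= 1 / 24 / g.+1%:R :> R.
Proof.
move=> q0 gK gq qK lnK192.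
have q1 : 1 <= q%:R :> R by rewrite ler1n.
have qgt0 : 0 < q%:R :> R by rewrite ltr0n.
have K0 : 0 < K%:R :> R by rewrite ltr0n (leq_ltn_trans _ gK).
set a : R := K%:R / q%:R.
have ga : g%:R <= a / 3.
  have -> : a / 3 = K%:R / (3 * q%:R) by rewrite /a; field; lra.
  exact: gq.
have aK : 27 / 4 * ln K%:R <= a.
  by rewrite /a ler_pdivlMr // mulrC -ler_pdivlMr //; lra.
have p2 : 2 ^+ g <= expR (a / 3).
  apply: (@le_trans _ _ (expR g%:R)); last by rewrite ler_expR.
  rewrite -[X in expR X]mulr1 expRM_natl; apply: lerXn2r; rewrite ?nnegrE ?expR_ge0 //.
  by apply: le_trans (expR_ge1Dx _).
have pK : (1 - 1 / (2 * q%:R)) ^+ K <= expR (- (a / 2)).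
  have -> : - (a / 2) = K%:R * (- (1 / (2 * q%:R))) by rewrite /a; field; lra.
  rewrite expRM_natl; apply: lerXn2r; rewrite ?nnegrE ?expR_ge0 ?expR_ge1Dx //.
  by rewrite subr_ge0 ler_pdivrMr; lra.
have pK0 : 0 <= (1 - 1 / (2 * q%:R)) ^+ K :> R.
  by rewrite exprn_ge0 // subr_ge0 ler_pdivrMr; lra.
rewrite ler_pdivlMr ?ltr0n //.
have gexp : g.+1%:R <= expR (ln K%:R) :> R by rewrite lnK ?posrE // ler_nat.
have prod_le : 2 ^+ g * (1 - 1 / (2 * q%:R)) ^+ K * g.+1%:R <=
    expR (a / 3) * expR (- (a / 2)) * expR (ln K%:R).
  apply: ler_pM => //; first by rewrite mulr_ge0 // exprn_ge0.
  by apply: ler_pM => //; rewrite exprn_ge0.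
apply: (le_trans prod_le); rewrite -!expRD.
apply: (@le_trans _ _ (expR (- (ln K%:R / 8)))); first by rewrite ler_expR; lra.
have e24 : 24 <= expR (ln K%:R / 8 : R) by apply: le_trans (expR_ge1Dx _); lra.
by rewrite expRN -div1r ler_pdivrMr ?expR_gt0 //; lra.
Qed.

Lemma expected_Rmd_large (R : realType) (c : R) (K N g q F' : nat) (d : 'I_K -> 'I_N) :
  0 < c -> (2 <= g)%N ->
  (g%:R : R) <= K%:R / (3 * q%:R) ->
  (q%:R : R) <= K%:R / (27 / 4 * ln (K%:R : R)) ->
  c * 'C(K, g)%:R * (ln ('C(K, g)%:R : R)) ^+ 2 <= F'%:R ->
  192 <= ln (K%:R : R) -> 192 <= c * ln (K%:R : R) ->
  @expected_Rmd R K N F' q g d <= (4 / 3 : R) * (K%:R / g.+1%:R).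
Proof.
move=> c0 g2 gq qK FF lnK192 clnK.
have g2R : 2 <= g%:R :> R by rewrite ler_nat.
have q0 : (0 < q)%N.
  (* For [q = 0] the quotient bounding [g] is 0 by the convention on division, against [2 <= g]. *)
  rewrite lt0n; apply/eqP => q0; move: gq; rewrite q0 mulr0 invr0 mulr0 => gq.
  by have := le_trans g2R gq; lra.
have q1 : 1 <= q%:R :> R by rewrite ler1n.
have gK : (g < K)%N.
  rewrite -(ltr_nat R); move: gq; rewrite ler_pdivlMr; last by lra.
  by have := @ler_wpM2l R g%:R (ler0n _ _) _ _ q1; lra.
have K0 : 0 < K%:R :> R by rewrite ltr0n (leq_ltn_trans _ gK).
have KC : (K <= 'C(K, g))%N by rewrite leq_bin_self // gK andbT (leq_trans _ g2).
have C0 : 0 < 'C(K, g)%:R :> R by rewrite (lt_le_trans K0) // ler_nat.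
set B : R := 'C(K, g)%:R in FF C0 *; set L := ln B in FF.
have lnL : ln K%:R <= L by rewrite ler_ln ?posrE // ler_nat.
have cL : 192 <= c * L by rewrite (le_trans clnK) // ler_pM2l.
(* Together with [muL] below this gives [mu >= 192 * L], hence both [L <= 3/224 * mu] and, as
   [L >= 192], [mu >= 192]. *)
have cLL : 192 * L <= c * L ^+ 2.
  by rewrite expr2 mulrA; apply: ler_wpM2r => //; lra.
set mu : R := F'%:R * q%:R / B.
have F0R : 0 < F'%:R :> R.
  by apply: lt_le_trans FF; apply: mulr_gt0; [apply: mulr_gt0 | apply: exprn_gt0; lra].
have F0 : (0 < F')%N by rewrite -(ltr0n R).
have muL : c * L ^+ 2 <= mu.
  rewrite /mu ler_pdivlMr //; apply: (@le_trans _ _ F'%:R); first by move: FF; lra.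
  by rewrite ler_peMr // ltW.
have small := @exp_moment_small R mu L g.+1%:R (ler0n _ _).

have tail := @lower_tail_small R K g q q0 gK gq qK lnK192.
have l0 : 0 < 1 / 8 :> R by lra.
apply: (le_trans (@expected_Rmd_le R K N g q F' d (1 / 8) (5 / 4 * mu) q0 (ltnW g2) F0 l0)).
rewrite -/B -/mu.
have F0q : 0 < q%:R * F'%:R :> R by rewrite mulr_gt0 //; lra.
have g1 : 0 < g.+1%:R :> R by rewrite ltr0n.
have main : 'C(K, g.+1)%:R <= K%:R / g.+1%:R * B.
  rewrite mulrAC ler_pdivlMr // mulrC -natrM mul_bin_left /B -natrM ler_nat.
  by rewrite leq_mul // leq_subr.
rewrite mulrC ler_pdivrMr //.
set D := _ + _ * _ in small *.
have D31 : D <= 31 / 24 * mu.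
  apply: small; try lra.
  by rewrite lnK ?posrE // ler_nat (leq_trans gK).
(* The budget splits as [4/3 = 31/24 + 1/24]: the first share pays for the sets of size [g + 1], the
   second for all others. *)
have -> : 4 / 3 * (K%:R / g.+1%:R) * (q%:R * F'%:R) =
   K%:R / g.+1%:R * B * (31 / 24 * mu) + K%:R * (F'%:R * q%:R * (1 / 24 / g.+1%:R)).
  by rewrite /mu; field; rewrite !gt_eqF.
apply: lerD.
  apply: (@le_trans _ _ ('C(K, g.+1)%:R * (31 / 24 * mu))).
    by rewrite ler_wpM2l.
  by rewrite ler_wpM2r //; lra.
by rewrite ler_wpM2l // ler_wpM2l // mulr_ge0.
Qed.

(** * Choice of the vanishing error term *)

Local Open Scope classical_set_scope.

Theorem theorem7 (R : realType) (c : R) :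
  0 < c ->
  exists eps : nat -> R, eps @ \oo --> (0 : R) /\
  forall (K N g q F' : nat) (M : R) (d : 'I_K -> 'I_N),
    0 < M -> M <= N%:R ->
    (q%:R : R) - 1 < N%:R / M <= q%:R ->
    (K < N)%N ->
    (2 <= g)%N ->
    (g%:R : R) <= K%:R / (3 * q%:R) ->
    (q%:R : R) <= K%:R / ((27 / 4 : R) * ln (K%:R : R)) ->
    (F'%:R : R) - 1 < c * 'C(K, g)%:R * (ln ('C(K, g)%:R : R)) ^+ 2 <= F'%:R ->
    @expected_Rmd R K N F' q g d <= (4 / 3 : R) * (K%:R / g.+1%:R) * (1 + eps K).
Proof.
move=> c0.
(* The error is 0 as soon as [K] meets both thresholds. Below them the value [K] suffices, because
   the rate is at most [K] and [g + 1 <= K + 1]. *)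
exists (fun K => if (192 <= ln (K%:R : R)) && (192 <= c * ln (K%:R : R)) then 0 else K%:R).
split.
  apply: cvg_near_cst.
  (* Beyond this index [ln K >= 192 + 192 / c], which implies both thresholds at once. *)
  exists (Num.truncn (expR (192 + 192 / c))).+1 => // K /= ltK.
  have eK : expR (192 + 192 / c) <= K%:R.
    by rewrite (le_trans (ltW (truncnS_gt _))) // ler_nat.
  have K0 := lt_le_trans (expR_gt0 _) eK.
  have lnK : 192 + 192 / c <= ln K%:R by rewrite -ler_expR lnK.
  have c192 : 0 < 192 / c by rewrite divr_gt0.
  rewrite ifT //; apply/andP; split; first lra.
  by rewrite mulrC -ler_pdivrMr //; lra.
move=> K N g q F' M d M0 MN /andP[_ Nq] _ g2 gq qK /andP[_ FF].
case: ifP => [/andP[lnK clnK]|_].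
  by rewrite addr0 mulr1; apply: expected_Rmd_large FF lnK clnK.
have q0 : (0 < q)%N.
  rewrite -(ltr0n R); apply: lt_le_trans Nq.
  by rewrite divr_gt0 // (lt_le_trans M0).
apply: (le_trans (expected_Rmd_le_users R g F' d q0)).
have gK : g.+1%:R <= 1 + K%:R :> R.
  rewrite -natr1 addrC lerD2l (le_trans gq) // ler_pdivrMr ?mulr_gt0 ?ltr0n //.
  rewrite ler_peMr //; suff : 1 <= q%:R :> R by lra.
  by rewrite ler1n.
rewrite -mulrA; apply: (@le_trans _ _ (K%:R / g.+1%:R * (1 + K%:R))).
  by rewrite mulrAC ler_pdivlMr ?ltr0n // ler_wpM2l.
by rewrite ler_peMl ?mulr_ge0 ?divr_ge0 ?addr_ge0 //; lra.
Qed.
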